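(* Let $G=(V,E)$ be a finite connected graph with $n=|V|$ vertices. Then the unperturbed Laplacian $\Delta_G$ never satisfies Condition (I): for every real orthonormal basis $(\phi_k)_{k=1}^n$ of eigenvectors of $\Delta_G$, the matrix $(\phi_k(j)^2)_{j,k=1}^n$ is not invertible.
   Context: $G=(V,E)$ is a finite graph with vertex set $V=\{1,\dots,n\}$; $j\sim k$ means $\{j,k\}\in E$. Its combinatorial Laplacian acts on $u:V\to\mathbb C$ by $\Delta_G u(j)=\sum_{k\sim j}(u(j)-u(k))$. Condition (I) for a real symmetric operator on $\mathbb C^V$ with real orthonormal eigenbasis $(\phi_k)_{k=1}^n$ is the requirement that the squared-eigenvector matrix $(\phi_k(j)^2)_{j,k=1}^n$ be invertible.
   Formalization: The formal theorem assumes that G has at least two vertices; for a single vertex the claim is false, since the Laplacian is 0, the eigenbasis is (±1), and the squared-eigenvector matrix (1) is invertible. *)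

(* Defs.v *)
From HB Require Import structures.
From mathcomp Require Import all_boot all_order all_algebra.
From mathcomp Require Import reals.
From mathcomp Require Import complex.

Set Implicit Arguments.
Unset Strict Implicit.
Unset Printing Implicit Defensive.

Import Order.TTheory GRing.Theory Num.Theory.
Local Open Scope ring_scope.

Record sgraph (n : nat) := SGraph {
  adj : rel 'I_n;
  adj_sym : symmetric adj;
  adj_irr : irreflexive adj
}.

(* Nonemptiness is not part of this definition: for n = 0 it holds vacuously. *)
Definition connected_graph (n : nat) (G : sgraph n) : Prop :=
  forall j k : 'I_n, connect (adj G) j k.

(* Functions V -> C are column vectors; the value of u at j is u j 0. *)
Definition laplacian (R : realType) (n : nat) (G : sgraph n)
    (u : 'cV[R[i]]_n) : 'cV[R[i]]_n :=
  \col_j \sum_(k | adj G j k) (u j 0 - u k 0).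

Definition inner (R : realType) (n : nat) (u v : 'cV[R[i]]_n) : R[i] :=
  \sum_(j < n) u j 0 * (v j 0)^*.

Definition complexify (R : realType) (n : nat) (u : 'cV[R]_n) : 'cV[R[i]]_n :=
  map_mx (real_complex R) u.

(* Real-valued vectors forming an orthonormal basis of the complex space C^V. *)
Definition real_orthonormal_basis (R : realType) (n : nat)
    (phi : 'I_n -> 'cV[R]_n) : Prop :=
  (forall k l : 'I_n,
     inner (complexify (phi k)) (complexify (phi l)) = (k == l)%:R) /\
  basis_of {: 'cV[R[i]]_n} [seq complexify (phi k) | k <- enum 'I_n].

Definition is_eigenvector (R : realType) (n : nat)
    (A : 'cV[R[i]]_n -> 'cV[R[i]]_n) (u : 'cV[R[i]]_n) : Prop :=
  u != 0 /\ exists lambda : R[i], A u = lambda *: u.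

Definition real_orthonormal_eigenbasis (R : realType) (n : nat)
    (A : 'cV[R[i]]_n -> 'cV[R[i]]_n) (phi : 'I_n -> 'cV[R]_n) : Prop :=
  real_orthonormal_basis phi /\
  forall k : 'I_n, is_eigenvector A (complexify (phi k)).

Definition squared_eigenvector_matrix (R : realType) (n : nat)
    (phi : 'I_n -> 'cV[R]_n) : 'M[R]_n :=
  \matrix_(j, k) (phi k j 0) ^+ 2.

(* Condition (I), as a property of the chosen eigenbasis. *)
Definition condition_I (R : realType) (n : nat)
    (phi : 'I_n -> 'cV[R]_n) : Prop :=
  squared_eigenvector_matrix phi \in unitmx.

(* Main.v *)
(** The sum of the entries of a Laplacian is zero, so an eigenvector whose
    entries do not sum to zero has eigenvalue 0 and, the graph being connected,
    is constant. An orthonormal eigenbasis [phi] contains such a vector [phi k],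
    since its members cannot all be orthogonal to the constants. Its column in
    the squared-eigenvector matrix is constant, equal to 1/n; as every row of
    that matrix sums to 1, the sum of all columns is n times column [k], a
    nontrivial linear relation when n > 1. *)
Require Import Defs.
From HB Require Import structures.
From mathcomp Require Import all_boot all_order all_algebra.
From mathcomp Require Import reals.
From mathcomp Require Import complex.

Set Implicit Arguments.
Unset Strict Implicit.
Unset Printing Implicit Defensive.

Import Order.TTheory GRing.Theory Num.Theory.
Local Open Scope ring_scope.

(** Each edge contributes two opposite differences, by symmetry of [adj]. *)
Lemma sum_laplacian (R : realType) (n : nat) (G : sgraph n) (u : 'cV[R[i]]_n) :
  \sum_j laplacian G u j 0 = 0.
Proof.
under eq_bigr => j _ do rewrite mxE sumrB.
rewrite sumrB; apply/eqP; rewrite subr_eq0; apply/eqP.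
rewrite [RHS](exchange_big_dep xpredT) //=.
by apply: eq_bigr => j _; apply: eq_bigl => k; rewrite adj_sym.
Qed.

(* Maximum principle: the set where [f] is maximal is closed under adjacency. *)
Lemma harmonic_constant (R : realDomainType) (n : nat) (G : sgraph n)
    (f : 'I_n -> R) :
  connected_graph G ->
  (forall j, \sum_(k | adj G j k) (f j - f k) = 0) ->
  forall j k, f j = f k.
Proof.
move=> conn harm j k.
pose m := [arg max_(i > j) f i]%O.
have max_m i : f i <= f m by rewrite /m; case: arg_maxP => // i0 _; apply.
have clos : closed (adj G) [pred i | f i == f m].
  apply: (intro_closed (sym_connect_sym (adj_sym G))) => x y xy.
  rewrite !inE => /eqP fx.
  (* At a maximum point all differences are nonnegative, so a zero sum forces each to vanish. *)
  have ge0 i : adj G x i -> 0 <= f x - f i by rewrite subr_ge0 fx.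
  have /eqP := harm x; rewrite psumr_eq0 // => /allP /(_ y (mem_index_enum _)).
  by rewrite xy /= subr_eq0 fx eq_sym.
have eq_m i : f i = f m.
  by have := closed_connect clos (conn i m); rewrite !inE eqxx => /eqP.
by rewrite !eq_m.
Qed.

Lemma laplacian_complexify (R : realType) (n : nat) (G : sgraph n)
    (u : 'cV[R]_n) (j : 'I_n) :
  laplacian G (complexify u) j 0
  = real_complex R (\sum_(k | adj G j k) (u j 0 - u k 0)).
Proof.
rewrite mxE rmorph_sum; apply: eq_bigr => k _.
by rewrite rmorphB !mxE.
Qed.

Lemma eigenvector_constant (R : realType) (n : nat) (G : sgraph n)
    (u : 'cV[R]_n) :
  connected_graph G ->
  is_eigenvector (@laplacian R n G) (complexify u) ->
  \sum_j u j 0 != 0 ->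
  forall j k, u j 0 = u k 0.
Proof.
move=> conn [_ [lambda eig]] sum_neq0.
have lambda0 : lambda = 0.
  have := sum_laplacian G (complexify u); rewrite eig.
  under eq_bigr => j _ do rewrite !mxE.
  rewrite -mulr_sumr -rmorph_sum => /eqP; rewrite mulf_eq0 => /orP[/eqP //|].
  by rewrite fmorph_eq0 (negPf sum_neq0).
(* The maximum principle needs an order, so the equation is pulled back from [R[i]] to [R]. *)
apply: (harmonic_constant (f := fun j => u j 0) conn) => j.
apply: (fmorph_inj (real_complex R)).
rewrite -[LHS](laplacian_complexify G).
by rewrite eig lambda0 scale0r mxE rmorph0.
Qed.

Lemma inner_complexify (R : realType) (n : nat) (u v : 'cV[R]_n) :
  inner (complexify u) (complexify v)
  = real_complex R (\sum_j u j 0 * v j 0).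
Proof.
rewrite /inner rmorph_sum; apply: eq_bigr => j _.
by rewrite rmorphM !mxE; congr (_ * _); rewrite /= /Num.conj /= oppr0.
Qed.

(** Conjugation is trivial on real vectors, so Hermitian orthonormality is orthogonality of a real
    matrix. *)
Lemma orthonormal_basis_mulmx (R : realType) (n : nat) (phi : 'I_n -> 'cV[R]_n) :
  real_orthonormal_basis phi ->
  (\matrix_(j, k) phi k j 0)^T *m (\matrix_(j, k) phi k j 0) = 1%:M.
Proof.
move=> [orth _]; apply/matrixP => k l; rewrite !mxE.
apply: (fmorph_inj (real_complex R)); rewrite rmorph_nat -orth inner_complexify.
by congr (real_complex R _); apply: eq_bigr => j _; rewrite !mxE.
Qed.

Theorem mainTheorem12 (R : realType) (n : nat) (G : sgraph n)
    (n_gt1 : (1 < n)%N) (G_connected : connected_graph G)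
    (phi : 'I_n -> 'cV[R]_n)
    (phi_eigenbasis : real_orthonormal_eigenbasis (@laplacian R n G) phi) :
  ~ condition_I phi.
Proof.
case: phi_eigenbasis => basis eig.
have PtP := orthonormal_basis_mulmx basis.
(* A one-sided inverse of a square matrix is two-sided: the rows of [P] are orthonormal too, whence
   [row_sum] below. *)
have PPt := mulmx1C PtP.
set P := (\matrix_(j, k) phi k j 0) in PtP PPt.
have [k sum_neq0] : exists k, \sum_j phi k j 0 != 0.
  (* Otherwise the nonzero all-ones row would be killed by the invertible [P]. *)
  apply/existsP; apply: contraT; rewrite negb_exists => /forallP all0.
  have ones0 : const_mx 1 *m P = 0 :> 'rV[R]_n.
    apply/rowP => k; rewrite !mxE -[RHS](eqP (negPn (all0 k))).
    by apply: eq_bigr => j _; rewrite !mxE mul1r.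
  have /rowP/(_ (Ordinal n_gt1)) : const_mx 1 = 0 :> 'rV[R]_n.
    by rewrite -[LHS]mulmx1 -PPt mulmxA ones0 mul0mx.
  by move/eqP; rewrite !mxE oner_eq0.
have phi_const := eigenvector_constant G_connected (eig k) sum_neq0.
rewrite /condition_I; set M := squared_eigenvector_matrix phi => M_unit.
have row_sum : M *m const_mx 1 = const_mx 1 :> 'cV[R]_n.
  apply/colP => j; have /matrixP/(_ j j) := PPt.
  rewrite !mxE eqxx mulr1n => norm1; rewrite -[RHS]norm1; apply: eq_bigr => l _.
  by rewrite !mxE mulr1 expr2.
(* The [n] equal entries of column [k] add up to the squared norm of [phi k], which is 1. *)
have col_k : M *m (n%:R *: delta_mx k 0) = const_mx 1 :> 'cV[R]_n.
  rewrite -scalemxAr -colE; apply/colP => j; have /matrixP/(_ k k) := PtP.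
  rewrite !mxE eqxx mulr1n => norm1; rewrite -[RHS]norm1.
  under eq_bigr => l _ do rewrite !mxE (phi_const l j) -expr2.
  by rewrite sumr_const card_ord mulr_natl.
(* Injectivity of [M] equates two preimages of the all-ones vector, which differ at any index other
   than [k]. *)
have /colP ones_eq : const_mx 1 = n%:R *: delta_mx k 0 :> 'cV[R]_n.
  by rewrite -(mulKmx M_unit (const_mx 1)) row_sum -col_k mulKmx.
have /card_gt0P[l] : (0 < #|predC1 k|)%N by rewrite cardC1 card_ord -subn1 subn_gt0.
rewrite !inE => l_neq_k.
have /eqP := ones_eq l.
by rewrite !mxE (negPf l_neq_k) mulr0 oner_eq0.
Qed.
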